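(* Let $K$ be a positive integer, let $p\in\mathbb{Z}$ with $p\ne 0$, and set $q=2K(2pK+1)$. Then \[ f\left(\tfrac{1}{2}\sqrt{p/q}\right)=\begin{cases}1/2 & \text{if } p \text{ is even},\\ 1/2-K/q & \text{if } p \text{ is odd},\end{cases} \] where $f(r)=\frac{4}{\pi^2}\sum_{k\ge0}\frac{\sec((2k+1)\pi r)}{(2k+1)^2}$.
   Context: The function $f$ is defined by $f(r)=\frac{4}{\pi^2}\sum_{k\ge0}\frac{\sec((2k+1)\pi r)}{(2k+1)^2}$, with $\sec x=1/\cos x$. Note that $p/q>0$ for all admissible $p,K$ (if $p<0$ then also $q<0$), so $\tfrac12\sqrt{p/q}$ is a positive real number. (For instance $K=1,p=-1$ gives $f(1/\sqrt{8})=1$.) *)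

(* Defs.v *)
From Stdlib Require Import Reals.
From Coquelicot Require Import Coquelicot.
Open Scope R_scope.

Definition f_term (r : R) (k : nat) : R :=
  4 / PI ^ 2 * (/ cos ((2 * INR k + 1) * PI * r) / (2 * INR k + 1) ^ 2).

Definition f_equals (r v : R) : Prop := is_series (f_term r) v.

(* Main.v *)
Require Import Defs.
From Stdlib Require Import Reals ZArith Lra Lia List.
From Coquelicot Require Import Coquelicot.
Open Scope R_scope.

(** Put [th = 2 r]. Expanding the secant into partial fractions and exchanging
    the order of summation in
    [sum_n sum_m (-1)^((m-1)/2) / (m (m^2 - th^2 n^2))] ([m], [n] odd) gives the
    reciprocity [f (th / 2) = 1/2 - (4 th / PI^2) T (1 / (2 th))], where
    [T x = sum_m (-1)^((m-1)/2) tan (PI m x) / m^2] has period 1. The exchange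
    is legitimate for badly approximable [th]: the distances of the numbers
    [th n], [n <= X], to the odd integers are separated by [c / X], which makes
    the secant series absolutely convergent.
    For [th = sqrt (p / q)] the numbers [th1 = th / (1 + 2 K th)] and
    [th2 = th / (1 - 2 K th)] have the same value of [T] as [th], and
    [th2 - th1 = 2 p], so that [f (th2 / 2) = (-1)^p f (th1 / 2)]. This is a
    linear equation for [T], hence determines [f (th / 2)]. *)

(** * Series of real numbers *)

(* Coquelicot states the next lemmas with the abstract [plus] and [mult], which [ring] and
   [lra] do not recognize. *)
Lemma sum_Sn_R (a : nat -> R) (n : nat) : sum_n a (S n) = sum_n a n + a (S n).
Proof. exact (sum_Sn a n). Qed.

Lemma sum_n_mult_l_R (c : R) (a : nat -> R) (n : nat) :
  sum_n (fun k => c * a k) n = c * sum_n a n.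
Proof. exact (sum_n_mult_l (K := R_Ring) c a n). Qed.

Lemma sum_n_plus_R (a b : nat -> R) (n : nat) :
  sum_n (fun k => a k + b k) n = sum_n a n + sum_n b n.
Proof. exact (sum_n_plus a b n). Qed.

Lemma is_series_mult_l_R (c : R) (a : nat -> R) (l : R) :
  is_series a l -> is_series (fun k => c * a k) (c * l).
Proof. exact (is_series_scal_l c a l). Qed.

Lemma is_series_plus_R (a b : nat -> R) (l m : R) :
  is_series a l -> is_series b m -> is_series (fun k => a k + b k) (l + m).
Proof. exact (is_series_plus a b l m). Qed.

Lemma is_series_eq (a b : nat -> R) (l m : R) :
  (forall k, a k = b k) -> l = m -> is_series a l -> is_series b m.
Proof. intros Hab ->; now apply is_series_ext. Qed.

Lemma is_series_telescope (s : nat -> R) (l : R) :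
  is_lim_seq s l -> is_series (fun k => s (S k) - s k) (l - s 0%nat).
Proof.
intros Hs.
change (is_lim_seq (sum_n (fun k => s (S k) - s k)) (l - s 0%nat)).
apply (is_lim_seq_ext (fun n => s (S n) - s 0%nat)).
- induction n as [|n IH]; rewrite ?sum_O, ?sum_Sn_R, <- ?IH; simpl; ring.
- apply is_lim_seq_minus'; [now apply is_lim_seq_incr_1 in Hs|apply is_lim_seq_const].
Qed.

Lemma ex_series_bounded (a : nat -> R) (M : R) :
  (forall k, 0 <= a k) -> (forall n, sum_n a n <= M) -> ex_series a.
Proof.
intros Ha HM.
destruct (ex_finite_lim_seq_incr (sum_n a) M) as [l Hl]; [|exact HM|now exists l].
intros n; rewrite sum_Sn_R; specialize (Ha (S n)); lra.
Qed.

Lemma sum_n_le_abel (a b w : nat -> R) (n : nat) :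
  (forall k, 0 <= w (S k) <= w k) -> (forall k, sum_n a k <= sum_n b k) ->
  sum_n (fun k => a k * w k) n <= sum_n (fun k => b k * w k) n.
Proof.
intros Hw Hab.
enough (H : sum_n (fun k => a k * w k) n
            <= sum_n (fun k => b k * w k) n - (sum_n b n - sum_n a n) * w n).
{ assert (Hn : 0 <= w n) by (specialize (Hw n); lra).
  pose proof (Rmult_le_pos (sum_n b n - sum_n a n) (w n)) as Hp.
  specialize (Hab n); lra. }
induction n as [|n IH]; [rewrite !sum_O; lra|].
specialize (Hw n); specialize (Hab n).
pose proof (Rmult_le_compat_l (sum_n b n - sum_n a n) (w (S n)) (w n)) as Hstep.
rewrite !sum_Sn_R; lra.
Qed.

Lemma is_series_sum_n (a : nat -> nat -> R) (v : nat -> R) (M : nat) :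
  (forall m, is_series (fun n => a n m) (v m)) ->
  is_series (fun n => sum_n (a n) M) (sum_n v M).
Proof.
intros H; induction M as [|M IH].
- rewrite sum_O; apply (is_series_ext (fun n => a n 0%nat)); [|apply H].
  intros n; now rewrite sum_O.
- rewrite sum_Sn_R; apply (is_series_ext (fun n => sum_n (a n) M + a n (S M))).
  + intros n; now rewrite sum_Sn_R.
  + now apply is_series_plus_R.
Qed.

Lemma is_lim_seq_sum_n (g : nat -> nat -> R) (h : nat -> R) (N : nat) :
  (forall n, is_lim_seq (fun M => g M n) (h n)) ->
  is_lim_seq (fun M => sum_n (g M) N) (sum_n h N).
Proof.
intros H; induction N as [|N IH].
- rewrite sum_O; apply (is_lim_seq_ext (fun M => g M 0%nat)); [|apply H].
  intros M; now rewrite sum_O.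
- rewrite sum_Sn_R; apply (is_lim_seq_ext (fun M => sum_n (g M) N + g M (S N))).
  + intros M; now rewrite sum_Sn_R.
  + now apply is_lim_seq_plus'.
Qed.

Lemma Series_tail_le (a B : nat -> R) (N : nat) : (forall n, Rabs (a n) <= B n) ->
  ex_series B -> Rabs (Series a - sum_n a N) <= Series B - sum_n B N.
Proof.
intros Ha HB.
assert (Habs : ex_series (fun n => Rabs (a n))).
{ apply (ex_series_le (V := R_CompleteNormedModule) _ B); [|exact HB].
  intros n; change (Rabs (Rabs (a n)) <= B n); now rewrite Rabs_Rabsolu. }
assert (Htail : forall b, ex_series b ->
  Series b - sum_n b N = Series (fun k => b (S N + k)%nat)).
{ intros b Hb; rewrite (Series_incr_n b (S N)) by (lia || exact Hb).
  simpl Init.Nat.pred; rewrite sum_n_Reals; ring. }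
rewrite !Htail by auto using ex_series_Rabs.
eapply Rle_trans.
- apply Series_Rabs; exact (proj1 (ex_series_incr_n (fun n => Rabs (a n)) (S N)) Habs).
- apply Series_le; [|exact (proj1 (ex_series_incr_n B (S N)) HB)].
  intros n; split; [apply Rabs_pos|apply Ha].
Qed.

Lemma tannery (g : nat -> nat -> R) (h B : nat -> R) :
  (forall M n, Rabs (g M n) <= B n) -> ex_series B ->
  (forall n, is_lim_seq (fun M => g M n) (h n)) ->
  ex_series h /\ is_lim_seq (fun M => Series (g M)) (Series h).
Proof.
intros Hg HB Hlim.
assert (Hh : forall n, Rabs (h n) <= B n).
{ intros n.
  apply (is_lim_seq_le (fun M => Rabs (g M n)) (fun _ => B n) (Rabs (h n)) (B n)).
  - intros M; apply Hg.
  - exact (is_lim_seq_abs _ _ (Hlim n)).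
  - apply is_lim_seq_const. }
split; [now apply (ex_series_le (V := R_CompleteNormedModule) _ B)|].
apply is_lim_seq_spec; intros [e He]; simpl.
assert (He4 : 0 < e / 4) by lra.
assert (Htail : exists N, Series B - sum_n B N < e / 4).
{ assert (HS : is_lim_seq (sum_n B) (Series B)) by exact (Series_correct _ HB).
  apply is_lim_seq_spec in HS.
  destruct (HS (mkposreal _ He4)) as [N HN]; exists N.
  specialize (HN N (Nat.le_refl N)); simpl in HN.
  apply Rabs_def2 in HN; lra. }
destruct Htail as [N HN].
pose proof (is_lim_seq_sum_n g h N Hlim) as Hfin; apply is_lim_seq_spec in Hfin.
destruct (Hfin (mkposreal _ He4)) as [M0 HM0]; exists M0; intros M HM.
specialize (HM0 M HM); simpl in HM0.
pose proof (Series_tail_le (g M) B N (Hg M) HB) as Hgtail.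
pose proof (Series_tail_le h B N Hh HB) as Hhtail.
apply Rabs_def2 in HM0; apply Rabs_le_between in Hgtail; apply Rabs_le_between in Hhtail.
apply Rabs_def1; lra.
Qed.

(** * Bessel's inequality *)

Ltac differentiable_continuous :=
  apply (ex_derive_continuous (V := R_NormedModule)); auto_derive; exact I.

Lemma RInt_of_derive (F f : R -> R) (a b : R) :
  (forall t, is_derive F t (f t)) -> (forall t, continuous f t) ->
  RInt f a b = F b - F a.
Proof. intros HF Hf; apply is_RInt_unique, (is_RInt_derive F f); auto. Qed.

Lemma ex_RInt_continuous_everywhere (f : R -> R) (a b : R) :
  (forall t, continuous f t) -> ex_RInt f a b.
Proof. intros Hf; apply (ex_RInt_continuous (V := R_CompleteNormedModule)); auto. Qed.

Lemma continuous_mult_R (f g : R -> R) (t : R) :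
  continuous f t -> continuous g t -> continuous (fun x => f x * g x) t.
Proof. exact (continuous_mult (K := R_AbsRing) f g t). Qed.

Lemma RInt_minus_continuous (f g : R -> R) (a b : R) :
  (forall t, continuous f t) -> (forall t, continuous g t) ->
  RInt (fun t => f t - g t) a b = RInt f a b - RInt g a b.
Proof. intros Hf Hg; apply (RInt_minus f g); now apply ex_RInt_continuous_everywhere. Qed.

Lemma RInt_scal_continuous (f : R -> R) (x a b : R) : (forall t, continuous f t) ->
  RInt (fun t => x * f t) a b = x * RInt f a b.
Proof. intros Hf; apply (RInt_scal f); now apply ex_RInt_continuous_everywhere. Qed.

Section Bessel.
Variables (a b c : R) (phi : nat -> R -> R).
Hypothesis a_le_b : a <= b.
Hypothesis c_pos : 0 < c.
Hypothesis phi_continuous : forall n t, continuous (phi n) t.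
Hypothesis phi_orthogonal :
  forall m n, m <> n -> RInt (fun t => phi m t * phi n t) a b = 0.
Hypothesis phi_sqr_norm : forall n, RInt (fun t => phi n t * phi n t) a b = c.

Let inner (f g : R -> R) : R := RInt (fun t => f t * g t) a b.

Let inner_comm (f g : R -> R) : inner f g = inner g f.
Proof. apply RInt_ext; intros t _; apply Rmult_comm. Qed.

Let inner_minus_scal (f g h : R -> R) (x : R) : (forall t, continuous f t) ->
  (forall t, continuous g t) -> (forall t, continuous h t) ->
  inner (fun t => f t - x * g t) h = inner f h - x * inner g h.
Proof.
intros Hf Hg Hh.
assert (Hfh : forall t, continuous (fun t => f t * h t) t) by auto using continuous_mult_R.
assert (Hgh : forall t, continuous (fun t => g t * h t) t) by auto using continuous_mult_R.
assert (Hxgh : forall t, continuous (fun t => x * (g t * h t)) t)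
  by (intros t; apply continuous_mult_R; [apply continuous_const|apply Hgh]).
unfold inner; rewrite <- RInt_scal_continuous, <- RInt_minus_continuous by assumption.
apply RInt_ext; intros t _; simpl; ring.
Qed.

Fixpoint bessel_residual (f : R -> R) (n : nat) : R -> R :=
  match n with
  | O => f
  | S m => fun t => bessel_residual f m t - inner f (phi m) / c * phi m t
  end.

Section Residual.
Variable f : R -> R.
Hypothesis f_continuous : forall t, continuous f t.

Let residual_continuous (n : nat) (t : R) : continuous (bessel_residual f n) t.
Proof.
induction n as [|n IH]; [apply f_continuous|].
apply (continuous_minus (V := R_NormedModule)); [exact IH|].
apply continuous_mult_R; [apply continuous_const|apply phi_continuous].
Qed.

Lemma inner_bessel_residual (n k : nat) : (n <= k)%nat ->
  inner (bessel_residual f n) (phi k) = inner f (phi k).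
Proof.
induction n as [|n IH]; intros Hnk; [reflexivity|]; simpl.
rewrite inner_minus_scal, IH by (lia || auto).
replace (inner (phi n) (phi k)) with 0 by (symmetry; apply phi_orthogonal; lia); ring.
Qed.

Lemma bessel_residual_sqr_norm (n : nat) :
  inner (bessel_residual f (S n)) (bessel_residual f (S n))
  = inner (bessel_residual f n) (bessel_residual f n) - inner f (phi n) ^ 2 / c.
Proof.
change (bessel_residual f (S n))
  with (fun t => bessel_residual f n t - inner f (phi n) / c * phi n t) at 1.
rewrite inner_minus_scal, !(inner_comm _ (bessel_residual f (S n))) by auto; simpl.
rewrite !inner_minus_scal, (inner_comm (phi n) (bessel_residual f n)) by auto.
rewrite inner_bessel_residual by lia.
replace (inner (phi n) (phi n)) with c by (symmetry; apply phi_sqr_norm); field; lra.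
Qed.

Lemma bessel_inequality (n : nat) :
  sum_n (fun k => RInt (fun t => f t * phi k t) a b ^ 2) n
  <= c * RInt (fun t => f t * f t) a b.
Proof.
assert (Hpartial : forall m, sum_n (fun k => inner f (phi k) ^ 2) m
  = c * (inner f f - inner (bessel_residual f (S m)) (bessel_residual f (S m))) :> R).
{ induction m as [|m IH].
  - rewrite sum_O, bessel_residual_sqr_norm; simpl bessel_residual; field; lra.
  - rewrite sum_Sn_R, IH, (bessel_residual_sqr_norm (S m)); field; lra. }
change (sum_n (fun k => inner f (phi k) ^ 2) n <= c * inner f f); rewrite Hpartial.
apply Rmult_le_compat_l; [lra|].
assert (0 <= inner (bessel_residual f (S n)) (bessel_residual f (S n))); [|lra].
apply RInt_ge_0; [exact a_le_b| |intros t _; apply Rle_0_sqr].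
apply ex_RInt_continuous_everywhere; intros t; now apply continuous_mult_R.
Qed.

Lemma bessel_coefficients_lim_0 :
  is_lim_seq (fun k => RInt (fun t => f t * phi k t) a b) 0.
Proof.
set (x := fun k => RInt (fun t => f t * phi k t) a b).
assert (Hx : is_lim_seq (fun k => x k ^ 2) 0).
{ apply ex_series_lim_0, (ex_series_bounded _ (c * RInt (fun t => f t * f t) a b)).
  - intros k; apply pow2_ge_0.
  - exact bessel_inequality. }
apply is_lim_seq_abs_0.
apply (is_lim_seq_ext (fun k => sqrt (x k ^ 2))).
- intros k; rewrite <- Rsqr_pow2; apply sqrt_Rsqr_abs.
- rewrite <- sqrt_0; apply (is_lim_seq_continuous sqrt); [|exact Hx].
  apply continuity_pt_sqrt; lra.
Qed.

End Residual.
End Bessel.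

(** * Trigonometric functions at odd multiples of a right angle *)

Definition nth_odd (k : nat) : R := 2 * INR k + 1.

Definition parity_sign (i : Z) : R := if Z.even i then 1 else -1.

Lemma nth_odd_ge1 (k : nat) : 1 <= nth_odd k.
Proof. unfold nth_odd; pose proof (pos_INR k); lra. Qed.

Lemma nth_odd_S (k : nat) : nth_odd (S k) = nth_odd k + 2.
Proof. unfold nth_odd; rewrite S_INR; ring. Qed.

Lemma IZR_nth_odd (k : nat) : IZR (2 * Z.of_nat k + 1) = nth_odd k.
Proof. unfold nth_odd; rewrite plus_IZR, mult_IZR, <- INR_IZR_INZ; reflexivity. Qed.

Lemma parity_sign_succ (i : Z) : parity_sign (Z.succ i) = - parity_sign i.
Proof.
unfold parity_sign; rewrite Z.even_succ, <- Z.negb_even.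
destruct (Z.even i); simpl; ring.
Qed.

Lemma parity_sign_odd_mul (k : nat) (i : Z) :
  parity_sign ((2 * Z.of_nat k + 1) * i) = parity_sign i.
Proof. unfold parity_sign; now rewrite Z.even_mul, Z.even_add, Z.even_mul. Qed.

Lemma parity_sign_inv (i : Z) : / parity_sign i = parity_sign i.
Proof. unfold parity_sign; destruct (Z.even i); field. Qed.

Lemma parity_sign_sqr (i : Z) : parity_sign i * parity_sign i = 1.
Proof. unfold parity_sign; destruct (Z.even i); ring. Qed.

Lemma Rabs_parity_sign (i : Z) : Rabs (parity_sign i) = 1.
Proof.
unfold parity_sign; destruct (Z.even i); [apply Rabs_R1|].
apply Rabs_m1.
Qed.

Lemma cos_add_mul_PI (x : R) (i : Z) : cos (x + IZR i * PI) = parity_sign i * cos x.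
Proof.
assert (Hsucc : forall j, cos (x + IZR (Z.succ j) * PI) = - cos (x + IZR j * PI)).
{ intros j; rewrite succ_IZR, <- neg_cos; f_equal; ring. }
induction i as [|i IH|i IH] using Z.peano_ind.
- rewrite Rmult_0_l, Rplus_0_r; unfold parity_sign; simpl; ring.
- rewrite Hsucc, IH, parity_sign_succ; ring.
- rewrite <- (Z.succ_pred i), Hsucc, parity_sign_succ in IH; lra.
Qed.

Lemma sin_add_mul_PI (x : R) (i : Z) : sin (x + IZR i * PI) = parity_sign i * sin x.
Proof.
rewrite <- !cos_shift; replace (PI / 2 - (x + IZR i * PI))
  with (PI / 2 - x + IZR (- i) * PI) by (rewrite opp_IZR; ring).
rewrite cos_add_mul_PI; unfold parity_sign; now rewrite Z.even_opp.
Qed.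

Lemma cos_nth_odd_PI2 (k : nat) : cos (nth_odd k * (PI / 2)) = 0.
Proof.
apply cos_eq_0_1; exists (Z.of_nat k); unfold nth_odd; rewrite INR_IZR_INZ; field.
Qed.

Lemma sin_nth_odd_PI2 (k : nat) : sin (nth_odd k * (PI / 2)) = (-1) ^ k.
Proof.
induction k as [|k IH].
- replace (nth_odd 0 * (PI / 2)) with (PI / 2) by (unfold nth_odd; simpl; ring).
  apply sin_PI2.
- replace (nth_odd (S k) * (PI / 2)) with (nth_odd k * (PI / 2) + PI)
    by (rewrite nth_odd_S; field).
  rewrite neg_sin, IH; simpl; ring.
Qed.

Lemma Rabs_sin_le (x : R) : Rabs (sin x) <= Rabs x.
Proof.
assert (Hpos : forall y, 0 < y -> Rabs (sin y) <= y).
{ intros y Hy; apply Rabs_le; pose proof (sin_lt_x y Hy); pose proof PI2_1.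
  destruct (Rle_dec y 1) as [Hy1|Hy1].
  - pose proof (sin_ge_0 y ltac:(lra) ltac:(lra)); lra.
  - pose proof (SIN_bound y); lra. }
destruct (Rtotal_order x 0) as [Hx|[-> |Hx]].
- rewrite <- Rabs_Ropp, <- sin_neg, (Rabs_left x Hx); apply Hpos; lra.
- rewrite sin_0; lra.
- rewrite (Rabs_pos_eq x) by lra; now apply Hpos.
Qed.

Lemma sin_ge_third (t : R) : 0 <= t <= PI / 2 -> t / 3 <= sin t.
Proof.
intros [Ht0 Ht]; pose proof PI_4.
destruct (sin_bound t 0 Ht0 ltac:(lra)) as [Hlower _].
replace (sin_approx t (2 * 0 + 1)) with (t - t * (t * t) / 6) in Hlower
  by (unfold sin_approx, sin_term; simpl; field).
nra.
Qed.

Lemma Rabs_cos_PI2_le (k : nat) (y : R) :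
  Rabs (cos (PI / 2 * y)) <= PI / 2 * Rabs (nth_odd k - y).
Proof.
replace (PI / 2 * y) with (nth_odd k * (PI / 2) - PI / 2 * (nth_odd k - y)) by ring.
rewrite cos_minus, cos_nth_odd_PI2, sin_nth_odd_PI2, Rmult_0_l, Rplus_0_l.
rewrite Rabs_mult, pow_1_abs, Rmult_1_l.
apply (Rle_trans _ _ _ (Rabs_sin_le _)).
rewrite Rabs_mult, (Rabs_pos_eq (PI / 2)) by (pose proof PI_RGT_0; lra); lra.
Qed.

Lemma leibniz_series : is_series (fun k => (-1) ^ k / nth_odd k) (PI / 4).
Proof.
replace (PI / 4) with (let (a, _) := exist_PI in a)
  by (rewrite <- Alt_PI_eq; unfold Alt_PI; field).
destruct exist_PI as [a Ha]; apply is_lim_seq_Reals in Ha.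
apply (is_lim_seq_ext _ (sum_n (fun k => (-1) ^ k / nth_odd k))) in Ha; [exact Ha|].
intros n; rewrite <- sum_n_Reals.
apply sum_n_ext; intros k; unfold tg_alt, PI_tg, nth_odd.
now rewrite plus_INR, mult_INR.
Qed.

(** * Fourier series at the origin *)

Lemma is_lim_slope (f : R -> R) (a l : R) :
  is_derive f a l -> is_lim (fun t => (f t - f a) / (t - a)) a l.
Proof.
intros Hf; apply is_derive_Reals in Hf; apply is_lim_spec; intros e.
destruct (Hf e (cond_pos e)) as [d Hd]; exists d; intros t Ht Hta.
replace t with (a + (t - a)) at 1 by ring.
apply Hd; [lra|exact Ht].
Qed.

Lemma continuous_div_extension (f u : R -> R) (a b df du : R) : a < b ->
  (forall t, continuous f t) -> (forall t, continuous u t) ->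
  f a = 0 -> u a = 0 -> is_derive f a df -> is_derive u a du ->
  du <> 0 -> (forall t, a < t <= b -> u t <> 0) ->
  {h : R -> R | (forall t, continuous h t) /\ forall t, a < t < b -> h t * u t = f t}.
Proof.
intros Hab Hf Hu Hfa Hua Hdf Hdu Hdu0 Hu0.
assert (Hdiv : forall t, a < t <= b -> continuous (fun t => f t / u t) t).
{ intros t Ht; apply continuous_mult_R; [apply Hf|].
  apply continuous_Rinv_comp; [apply Hu|now apply Hu0]. }
assert (Ha : filterlim (fun t => f t / u t) (at_right a) (locally (df / du))).
{ assert (Hlim : is_lim (fun t => f t / u t) a (df / du)).
  { apply (is_lim_ext_loc (fun t => (f t - f a) / (t - a) / ((u t - u a) / (t - a)))).
    - exists (mkposreal 1 Rlt_0_1); intros t _ Hta.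
      rewrite Hfa, Hua, !Rminus_0_r; unfold Rdiv; rewrite Rinv_mult, Rinv_inv.
      transitivity (f t * / u t * (/ (t - a) * (t - a))); [ring|].
      rewrite Rinv_l; [ring|lra].
    - apply (is_lim_div _ _ a df du); try now apply is_lim_slope.
      + injection; exact Hdu0.
      + exact I. }
  intros P HP; destruct (Hlim P HP) as [d Hd]; exists d; intros t Ht Hat.
  apply Hd; [exact Ht|lra]. }
destruct (C0_extension_lt (fun t => f t / u t) (df / du) (f b / u b) a b Hab)
  as [h [Hh [Heq _]]].
- intros t Ht; apply Hdiv; lra.
- exact Ha.
- intros P HP; apply filter_le_within; exact (Hdiv b ltac:(lra) P HP).
- exists h; split; [exact Hh|]; intros t Ht; rewrite (Heq t Ht).
  field; apply Hu0; lra.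
Qed.

Lemma RInt_sin_mul_sin (m n : nat) : m <> n ->
  RInt (fun t => sin (2 * INR m * t) * sin (2 * INR n * t)) 0 (PI / 2) = 0 :> R.
Proof.
intros Hmn; pose proof (pos_INR m); pose proof (pos_INR n).
assert (Hd : INR m - INR n <> 0) by (intros E; apply Hmn, INR_eq; lra).
assert (Hs : INR m + INR n <> 0) by lra.
rewrite (RInt_of_derive (fun t => sin (2 * (INR m - INR n) * t) / (4 * (INR m - INR n))
                                  - sin (2 * (INR m + INR n) * t) / (4 * (INR m + INR n)))).
- rewrite !Rmult_0_r, sin_0, !INR_IZR_INZ, <- minus_IZR, <- plus_IZR.
  replace (2 * IZR (Z.of_nat m - Z.of_nat n) * (PI / 2))
    with (IZR (Z.of_nat m - Z.of_nat n) * PI) by field.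
  replace (2 * IZR (Z.of_nat m + Z.of_nat n) * (PI / 2))
    with (IZR (Z.of_nat m + Z.of_nat n) * PI) by field.
  rewrite !(sin_eq_0_1 (IZR _ * PI)) by eauto; unfold Rdiv; ring.
- intros t; auto_derive; [exact I|].
  rewrite Rmult_minus_distr_l, Rmult_plus_distr_l.
  replace ((2 * INR m - 2 * INR n) * t) with (2 * INR m * t - 2 * INR n * t) by ring.
  replace ((2 * INR m + 2 * INR n) * t) with (2 * INR m * t + 2 * INR n * t) by ring.
  rewrite cos_minus, cos_plus; field; split; assumption.
- intros t; differentiable_continuous.
Qed.

Lemma RInt_sin_sqr (n : nat) : n <> 0%nat ->
  RInt (fun t => sin (2 * INR n * t) * sin (2 * INR n * t)) 0 (PI / 2) = PI / 4 :> R.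
Proof.
intros Hn; assert (Hn0 : INR n <> 0) by now apply not_0_INR.
rewrite (RInt_of_derive (fun t => t / 2 - sin (2 * (2 * INR n * t)) / (8 * INR n))).
- replace (2 * (2 * INR n * (PI / 2))) with (0 + 2 * INR n * PI) by field.
  rewrite sin_period, !Rmult_0_r, sin_0; field; exact Hn0.
- intros t; auto_derive; [exact I|].
  rewrite cos_2a_sin; field; exact Hn0.
- intros t; differentiable_continuous.
Qed.

Lemma RInt_sin_lim_0 (h : R -> R) : (forall t, continuous h t) ->
  is_lim_seq (fun n => RInt (fun t => h t * sin (2 * INR n * t)) 0 (PI / 2)) 0.
Proof.
intros Hh; pose proof PI_RGT_0.
apply is_lim_seq_incr_1.
apply (bessel_coefficients_lim_0 0 (PI / 2) (PI / 4) (fun n t => sin (2 * INR (S n) * t)));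
  try lra; try exact Hh.
- intros n t; differentiable_continuous.
- intros m n Hmn; apply RInt_sin_mul_sin; lia.
- intros n; apply RInt_sin_sqr; lia.
Qed.

Lemma RInt_cos_nth_odd (k : nat) :
  RInt (fun t => cos (nth_odd k * t)) 0 (PI / 2) = (-1) ^ k / nth_odd k :> R.
Proof.
pose proof (nth_odd_ge1 k).
rewrite (RInt_of_derive (fun t => sin (nth_odd k * t) / nth_odd k)).
- rewrite sin_nth_odd_PI2, Rmult_0_r, sin_0; field; lra.
- intros t; auto_derive; [exact I|field; lra].
- intros t; differentiable_continuous.
Qed.

(* With [h t = (g t - g 0) / (2 sin t)], the k-th term differs from that of the constant
   function [g 0] by the integral of [h t (sin (2 (k + 1) t) - sin (2 k t))], which telescopes. *)
Lemma is_series_RInt_cos_nth_odd (g : R -> R) :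
  (forall t, continuous g t) -> ex_derive g 0 ->
  is_series (fun k => RInt (fun t => g t * cos (nth_odd k * t)) 0 (PI / 2)) (PI / 4 * g 0).
Proof.
intros Hg [dg Hdg]; pose proof PI_RGT_0 as HPI.
destruct (continuous_div_extension (fun t => g t - g 0) (fun t => 2 * sin t) 0 (PI / 2) dg 2)
  as [h [Hh Hhg]]; try lra.
- intros t; apply (continuous_minus (V := R_NormedModule)); [apply Hg|apply continuous_const].
- intros t; differentiable_continuous.
- rewrite sin_0; ring.
- auto_derive; [now exists dg|].
  replace (Derive (fun x => g x) 0) with dg by (symmetry; now apply is_derive_unique); ring.
- auto_derive; [exact I|rewrite cos_0; ring].
- intros t Ht; pose proof (sin_gt_0 t); lra.
- set (s := fun n => RInt (fun t => h t * sin (2 * INR n * t)) 0 (PI / 2)).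
  assert (Hs : is_series (fun k => s (S k) - s k) (0 - s 0%nat))
    by (apply is_series_telescope, RInt_sin_lim_0, Hh).
  pose proof (is_series_plus_R _ _ _ _ Hs (is_series_mult_l_R (g 0) _ _ leibniz_series)) as Hsum.
  revert Hsum; apply is_series_eq.
  2:{ unfold s; rewrite (RInt_ext _ (fun _ => 0)), RInt_const.
      - unfold scal; simpl; unfold mult; simpl; ring.
      - intros t _; simpl; rewrite Rmult_0_r, Rmult_0_l, sin_0; ring. }
  intros k; rewrite <- RInt_cos_nth_odd; unfold s.
  assert (Hcos : forall x t, continuous (fun t => cos (x * t)) t)
    by (intros x t; differentiable_continuous).
  assert (Hsin : forall x t, continuous (fun t => h t * sin (x * t)) t).
  { intros x t; apply continuous_mult_R; [apply Hh|].
    differentiable_continuous. }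
  rewrite <- RInt_minus_continuous, <- RInt_scal_continuous by auto.
  rewrite (RInt_ext _ (fun t => g t * cos (nth_odd k * t) - g 0 * cos (nth_odd k * t))).
  + rewrite RInt_minus_continuous; [simpl; ring| |]; intros t; apply continuous_mult_R; auto.
    apply continuous_const.
  + intros t Ht; rewrite Rmin_left, Rmax_right in Ht by lra.
    replace (g t * cos (nth_odd k * t)) with ((g t - g 0 + g 0) * cos (nth_odd k * t)) by ring.
    rewrite <- Hhg by exact Ht; rewrite S_INR; unfold nth_odd.
    replace (2 * (INR k + 1) * t) with ((2 * INR k + 1) * t + t) by ring.
    replace (2 * INR k * t) with ((2 * INR k + 1) * t - t) by ring.
    rewrite sin_plus, sin_minus; simpl; ring.
Qed.

(** * Partial fractions of the secant and the tangent *)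

Lemma nth_odd_minus_neq0 (k : nat) (y : R) : cos (PI / 2 * y) <> 0 -> nth_odd k - y <> 0.
Proof.
intros Hy E; apply Hy; replace y with (nth_odd k) by lra.
rewrite Rmult_comm; apply cos_nth_odd_PI2.
Qed.

Lemma nth_odd_plus_neq0 (k : nat) (y : R) : cos (PI / 2 * y) <> 0 -> nth_odd k + y <> 0.
Proof.
intros Hy; replace (nth_odd k + y) with (nth_odd k - - y) by ring.
apply nth_odd_minus_neq0; now rewrite Ropp_mult_distr_r_reverse, cos_neg.
Qed.

Lemma nth_odd_sqr_minus_neq0 (k : nat) (y : R) :
  cos (PI / 2 * y) <> 0 -> nth_odd k ^ 2 - y ^ 2 <> 0.
Proof.
intros Hy; replace (nth_odd k ^ 2 - y ^ 2) with ((nth_odd k - y) * (nth_odd k + y)) by ring.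
apply Rmult_integral_contrapositive_currified;
  [now apply nth_odd_minus_neq0|now apply nth_odd_plus_neq0].
Qed.

Lemma RInt_cos_mul_cos_nth_odd (y : R) (k : nat) : cos (PI / 2 * y) <> 0 ->
  RInt (fun t => cos (y * t) * cos (nth_odd k * t)) 0 (PI / 2)
  = (-1) ^ k * cos (PI / 2 * y) * (nth_odd k / (nth_odd k ^ 2 - y ^ 2)) :> R.
Proof.
intros Hy; pose proof (nth_odd_sqr_minus_neq0 k y Hy) as Hsqr.
pose proof (nth_odd_minus_neq0 k y Hy); pose proof (nth_odd_plus_neq0 k y Hy).
rewrite (RInt_of_derive (fun t => (sin (nth_odd k * t + y * t) / (nth_odd k + y)
                                   + sin (nth_odd k * t - y * t) / (nth_odd k - y)) / 2)).
- rewrite !Rmult_0_r, Rplus_0_r, Rminus_0_r, sin_0, (Rmult_comm y (PI / 2)).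
  rewrite sin_plus, sin_minus, cos_nth_odd_PI2, sin_nth_odd_PI2.
  field; repeat split; assumption.
- intros t; auto_derive; [exact I|].
  replace (nth_odd k * t + - (y * t)) with (nth_odd k * t - y * t) by ring.
  rewrite cos_minus, cos_plus; field; split; assumption.
- intros t; differentiable_continuous.
Qed.

Lemma RInt_sin_mul_cos_nth_odd (y : R) (k : nat) : cos (PI / 2 * y) <> 0 ->
  RInt (fun t => sin (y * (PI / 2 - t)) * cos (nth_odd k * t)) 0 (PI / 2)
  = y * cos (PI / 2 * y) / (nth_odd k ^ 2 - y ^ 2) :> R.
Proof.
intros Hy; pose proof (nth_odd_sqr_minus_neq0 k y Hy) as Hsqr.
pose proof (nth_odd_minus_neq0 k y Hy); pose proof (nth_odd_plus_neq0 k y Hy).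
rewrite (RInt_of_derive
  (fun t => (cos (y * (PI / 2 - t) - nth_odd k * t) / (nth_odd k + y)
             - cos (y * (PI / 2 - t) + nth_odd k * t) / (nth_odd k - y)) / 2)).
- rewrite Rminus_diag, !Rmult_0_r, !Rminus_0_r, Rplus_0_r, Rplus_0_l, Rminus_0_l, cos_neg.
  rewrite cos_nth_odd_PI2, (Rmult_comm y (PI / 2)); field; repeat split; assumption.
- intros t; evar_last; [auto_derive; [exact I|reflexivity]|].
  rewrite !sin_plus, sin_neg, cos_neg; change (PI / 2 - t) with (PI / 2 + - t).
  field; split; assumption.
- intros t; differentiable_continuous.
Qed.

Lemma sec_partial_fractions (y : R) : cos (PI / 2 * y) <> 0 ->
  is_series (fun k => (-1) ^ k * (nth_odd k / (nth_odd k ^ 2 - y ^ 2)))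
    (PI / 4 / cos (PI / 2 * y)).
Proof.
intros Hy.
assert (Hfourier : is_series
  (fun k => RInt (fun t => cos (y * t) * cos (nth_odd k * t)) 0 (PI / 2))
  (PI / 4 * cos (y * 0))).
{ apply is_series_RInt_cos_nth_odd; [intros t|].
  - differentiable_continuous.
  - auto_derive; exact I. }
apply (is_series_mult_l_R (/ cos (PI / 2 * y))) in Hfourier.
revert Hfourier; apply is_series_eq.
- intros k; rewrite RInt_cos_mul_cos_nth_odd by exact Hy.
  field; split; [now apply nth_odd_sqr_minus_neq0|exact Hy].
- rewrite Rmult_0_r, cos_0; field; exact Hy.
Qed.

Lemma tan_partial_fractions (y : R) : cos (PI / 2 * y) <> 0 -> y <> 0 ->
  is_series (fun k => / (nth_odd k ^ 2 - y ^ 2)) (PI / (4 * y) * tan (PI / 2 * y)).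
Proof.
intros Hy Hy0.
assert (Hfourier : is_series
  (fun k => RInt (fun t => sin (y * (PI / 2 - t)) * cos (nth_odd k * t)) 0 (PI / 2))
  (PI / 4 * sin (y * (PI / 2 - 0)))).
{ apply (is_series_RInt_cos_nth_odd (fun t => sin (y * (PI / 2 - t)))); [intros t|].
  - differentiable_continuous.
  - auto_derive; exact I. }
apply (is_series_mult_l_R (/ (y * cos (PI / 2 * y)))) in Hfourier.
revert Hfourier; apply is_series_eq.
- intros k; rewrite RInt_sin_mul_cos_nth_odd by exact Hy.
  field; repeat split; [now apply nth_odd_sqr_minus_neq0|exact Hy|exact Hy0].
- unfold tan; rewrite Rminus_0_r, (Rmult_comm y (PI / 2)); field; split; assumption.
Qed.

Lemma is_series_inv_nth_odd_sqr : is_series (fun k => / nth_odd k ^ 2) (PI ^ 2 / 8).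
Proof.
assert (Hfourier : is_series
  (fun k => RInt (fun t => (PI / 2 - t) * cos (nth_odd k * t)) 0 (PI / 2))
  (PI / 4 * (PI / 2 - 0))).
{ apply (is_series_RInt_cos_nth_odd (fun t => PI / 2 - t)); [intros t|].
  - differentiable_continuous.
  - auto_derive; exact I. }
revert Hfourier; apply is_series_eq; [intros k|field].
pose proof (nth_odd_ge1 k).
rewrite (RInt_of_derive (fun t => (PI / 2 - t) * (sin (nth_odd k * t) / nth_odd k)
                                  - cos (nth_odd k * t) / nth_odd k ^ 2)).
- rewrite !Rmult_0_r, cos_nth_odd_PI2, cos_0, sin_0; field; lra.
- intros t; auto_derive; [exact I|field; lra].
- intros t; differentiable_continuous.
Qed.

Lemma Rabs_alternating_sum_le (b : nat -> R) (B : R) (n : nat) :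
  (forall k, Rabs (b k) <= B) ->
  (forall k, b k < 0 < b (S k) \/ b (S k) <= b k < 0 \/ 0 < b (S k) <= b k) ->
  Rabs (sum_n (fun k => (-1) ^ k * b k) n) <= 2 * B.
Proof.
intros HB Hb.
assert (HB' : forall k, - B <= b k <= B) by (intros k; now apply Rabs_le_between).
set (u := fun k => (-1) ^ k * sum_n (fun j => (-1) ^ j * b j) k).
assert (Hu : forall k, u (S k) = b (S k) - u k).
{ intros k; unfold u; rewrite sum_Sn_R.
  assert (Hsqr : (-1) ^ k * (-1) ^ k = 1)
    by (rewrite <- Rpow_mult_distr, <- (pow1 k); f_equal; ring).
  replace ((-1) ^ S k) with (- (-1) ^ k) by (simpl; ring).
  transitivity ((-1) ^ k * (-1) ^ k * b (S k) - (-1) ^ k * sum_n (fun j => (-1) ^ j * b j) k);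
    [ring|rewrite Hsqr; ring]. }
assert (Hinv : forall k, (b k < 0 -> b k <= u k <= 0) /\
  (0 < b k -> - (2 * B) <= u k <= 2 * B /\ - (2 * B) <= u k - b k <= 2 * B)).
{ induction k as [|k [IHneg IHpos]].
  - unfold u; rewrite sum_O; simpl; specialize (HB' 0%nat); split; intros; lra.
  - rewrite Hu; pose proof (HB' k); pose proof (HB' (S k)).
    destruct (Hb k) as [Hk|[Hk|Hk]];
      [specialize (IHneg ltac:(lra))|specialize (IHneg ltac:(lra))|specialize (IHpos ltac:(lra))];
      split; intros; lra. }
assert (Hn : Rabs (u n) <= 2 * B).
{ apply Rabs_le; pose proof (HB' n); destruct (Hinv n) as [Hneg Hpos].
  destruct (Hb n) as [Hk|[Hk|Hk]];
    [specialize (Hneg ltac:(lra))|specialize (Hneg ltac:(lra))|specialize (Hpos ltac:(lra))]; lra. }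
unfold u in Hn; now rewrite Rabs_mult, pow_1_abs, Rmult_1_l in Hn.
Qed.

Lemma Rabs_alternating_inv_sum_le (z d : R) (n : nat) : 0 < d ->
  (forall k, d <= Rabs (nth_odd k + z)) ->
  Rabs (sum_n (fun k => (-1) ^ k * / (nth_odd k + z)) n) <= 2 / d.
Proof.
intros Hd Hz.
assert (Hz0 : forall k, nth_odd k + z <> 0).
{ intros k E; specialize (Hz k); rewrite E, Rabs_R0 in Hz; lra. }
apply Rabs_alternating_sum_le.
- intros k; rewrite Rabs_inv; now apply Rinv_le_contravar.
- intros k; pose proof (nth_odd_S k) as HS.
  destruct (Rdichotomy _ _ (Hz0 k)) as [Hk|Hk], (Rdichotomy _ _ (Hz0 (S k))) as [HSk|HSk];
    try lra.
  + right; left; split; [|now apply Rinv_lt_0_compat].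
    apply Ropp_le_cancel; rewrite <- !Rinv_opp; apply Rinv_le_contravar; lra.
  + left; split; [now apply Rinv_lt_0_compat|now apply Rinv_0_lt_compat].
  + right; right; split; [now apply Rinv_0_lt_compat|].
    apply Rinv_le_contravar; lra.
Qed.

Lemma sec_partial_sum_bound (y : R) (n : nat) : cos (PI / 2 * y) <> 0 ->
  Rabs (sum_n (fun k => (-1) ^ k * (nth_odd k / (nth_odd k ^ 2 - y ^ 2))) n)
  <= PI / Rabs (cos (PI / 2 * y)).
Proof.
intros Hy; pose proof PI_RGT_0 as HPI; pose proof (Rabs_pos_lt _ Hy) as Hcos.
set (d := 2 / PI * Rabs (cos (PI / 2 * y))).
assert (Hd : 0 < d) by (apply Rmult_lt_0_compat; [apply Rdiv_lt_0_compat|]; lra).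
assert (Hdist : forall k z, Rabs (cos (PI / 2 * z)) = Rabs (cos (PI / 2 * y)) ->
  d <= Rabs (nth_odd k - z)).
{ intros k z Hz; apply (Rmult_le_reg_l (PI / 2)); [lra|].
  replace (PI / 2 * d) with (Rabs (cos (PI / 2 * z)))
    by (rewrite Hz; unfold d; field; lra).
  apply Rabs_cos_PI2_le. }
assert (Hplus : Rabs (sum_n (fun k => (-1) ^ k * / (nth_odd k + y)) n) <= 2 / d).
{ apply Rabs_alternating_inv_sum_le; [exact Hd|intros k].
  replace (nth_odd k + y) with (nth_odd k - - y) by ring; apply Hdist.
  now rewrite Ropp_mult_distr_r_reverse, cos_neg. }
assert (Hminus : Rabs (sum_n (fun k => (-1) ^ k * / (nth_odd k + - y)) n) <= 2 / d).
{ apply Rabs_alternating_inv_sum_le; [exact Hd|intros k; now apply Hdist]. }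
rewrite (sum_n_ext _ (fun k => / 2 * ((-1) ^ k * / (nth_odd k + y)
                                      + (-1) ^ k * / (nth_odd k + - y)))).
- rewrite sum_n_mult_l_R, sum_n_plus_R.
  replace (PI / Rabs (cos (PI / 2 * y))) with (/ 2 * (2 / d + 2 / d))
    by (unfold d; field; lra).
  rewrite Rabs_mult, Rabs_pos_eq by lra; apply Rmult_le_compat_l; [lra|].
  apply (Rle_trans _ _ _ (Rabs_triang _ _)); now apply Rplus_le_compat.
- intros k; pose proof (nth_odd_sqr_minus_neq0 k y Hy).
  pose proof (nth_odd_minus_neq0 k y Hy); pose proof (nth_odd_plus_neq0 k y Hy).
  cbn -[pow]; field; repeat split; assumption.
Qed.

Definition sec_minus_one_term (y : R) (k : nat) : R :=
  (-1) ^ k / (nth_odd k * (nth_odd k ^ 2 - y ^ 2)).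

Lemma sec_minus_one_term_eq (y : R) (k : nat) : cos (PI / 2 * y) <> 0 -> y <> 0 ->
  sec_minus_one_term y k
  = / y ^ 2 * ((-1) ^ k * (nth_odd k / (nth_odd k ^ 2 - y ^ 2)) + -1 * ((-1) ^ k / nth_odd k)).
Proof.
intros Hy Hy0; pose proof (nth_odd_sqr_minus_neq0 k y Hy); pose proof (nth_odd_ge1 k).
unfold sec_minus_one_term; field; repeat split; lra.
Qed.

Lemma sec_minus_one_partial_fractions (y : R) : cos (PI / 2 * y) <> 0 -> y <> 0 ->
  is_series (sec_minus_one_term y) (PI / 4 / y ^ 2 * (/ cos (PI / 2 * y) - 1)).
Proof.
intros Hy Hy0.
pose proof (is_series_plus_R _ _ _ _ (sec_partial_fractions y Hy)
              (is_series_mult_l_R (-1) _ _ leibniz_series)) as Hdiff.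
apply (is_series_mult_l_R (/ y ^ 2)) in Hdiff; revert Hdiff; apply is_series_eq.
- intros k; symmetry; now apply sec_minus_one_term_eq.
- field; split; assumption.
Qed.

Lemma sec_minus_one_partial_sum_bound (y : R) (n : nat) : cos (PI / 2 * y) <> 0 -> y <> 0 ->
  Rabs (sum_n (sec_minus_one_term y) n) <= 2 * PI * / (y ^ 2 * Rabs (cos (PI / 2 * y))).
Proof.
intros Hy Hy0; pose proof PI_RGT_0 as HPI.
pose proof (Rabs_pos_lt _ Hy) as Hcos; pose proof (pow2_gt_0 _ Hy0) as Hsqr.
assert (Hsec : Rabs (sum_n (fun k => (-1) ^ k * (nth_odd k / (nth_odd k ^ 2 - y ^ 2))) n)
               <= PI / Rabs (cos (PI / 2 * y))) by now apply sec_partial_sum_bound.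
assert (Hleibniz : Rabs (sum_n (fun k => (-1) ^ k / nth_odd k) n)
                   <= PI / Rabs (cos (PI / 2 * y))).
{ assert (Hcos0 : cos (PI / 2 * 0) = 1) by (rewrite Rmult_0_r; apply cos_0).
  pose proof (sec_partial_sum_bound 0 n) as Hbound0; rewrite Hcos0, Rabs_R1 in Hbound0.
  rewrite (sum_n_ext _ (fun k => (-1) ^ k * (nth_odd k / (nth_odd k ^ 2 - 0 ^ 2)))).
  - apply (Rle_trans _ _ _ (Hbound0 R1_neq_R0)), Rmult_le_compat_l; [lra|].
    apply Rinv_le_contravar; [exact Hcos|apply Rabs_le, COS_bound].
  - intros k; pose proof (nth_odd_ge1 k); cbn -[pow]; field; nra. }
rewrite (sum_n_ext _ _ _ (fun k => sec_minus_one_term_eq y k Hy Hy0)).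
rewrite sum_n_mult_l_R, sum_n_plus_R, sum_n_mult_l_R.
rewrite Rabs_mult, Rabs_pos_eq by (left; now apply Rinv_0_lt_compat).
replace (2 * PI * / (y ^ 2 * Rabs (cos (PI / 2 * y))))
  with (/ y ^ 2 * (PI / Rabs (cos (PI / 2 * y)) + PI / Rabs (cos (PI / 2 * y))))
  by (field; split; lra).
apply Rmult_le_compat_l; [left; now apply Rinv_0_lt_compat|].
apply (Rle_trans _ _ _ (Rabs_triang _ _)), Rplus_le_compat; [exact Hsec|].
now rewrite Rabs_mult, Rabs_m1, Rmult_1_l.
Qed.

(** * Sums of reciprocals of separated numbers *)

Definition inv_sum (l : list nat) : R := fold_right (fun j r => / INR j + r) 0 l.

Definition harmonic (n : nat) : R := inv_sum (seq 1 n).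

Lemma inv_sum_app (l1 l2 : list nat) : inv_sum (l1 ++ l2) = inv_sum l1 + inv_sum l2.
Proof. induction l1 as [|j l1 IH]; simpl; [|rewrite IH]; ring. Qed.

Lemma harmonic_S (n : nat) : harmonic (S n) = harmonic n + / INR (S n).
Proof.
unfold harmonic; rewrite seq_S, inv_sum_app; simpl; now rewrite Rplus_0_r.
Qed.

Lemma exists_ge_length (l : list nat) : NoDup l -> (forall j, In j l -> (1 <= j)%nat) ->
  l <> nil -> exists j, In j l /\ (length l <= j)%nat.
Proof.
intros Hdup Hpos Hnil.
destruct (Exists_dec (fun j => (length l <= j)%nat) l) as [H|H].
- intros j; destruct (le_dec (length l) j); [left|right]; assumption.
- now apply Exists_exists in H.
- apply Forall_Exists_neg in H; rewrite Forall_forall in H.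
  assert (Hincl : incl l (seq 1 (pred (length l)))).
  { intros j Hj; apply in_seq; specialize (H j Hj); specialize (Hpos j Hj); lia. }
  pose proof (NoDup_incl_length Hdup Hincl) as Hlen; rewrite length_seq in Hlen.
  destruct l; [now elim Hnil|simpl in Hlen; lia].
Qed.

Lemma inv_sum_le_harmonic (l : list nat) : NoDup l -> (forall j, In j l -> (1 <= j)%nat) ->
  inv_sum l <= harmonic (length l).
Proof.
remember (length l) as n eqn:Hn; revert l Hn.
induction n as [|n IH]; intros l Hn Hdup Hpos.
- destruct l; [apply Rle_refl|discriminate].
- destruct (exists_ge_length l Hdup Hpos) as [j [Hj Hjn]]; [now intros ->|].
  apply in_split in Hj; destruct Hj as [l1 [l2 ->]].
  assert (Hrest : inv_sum (l1 ++ l2) <= harmonic n).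
  { apply IH.
    - rewrite length_app in *; simpl in Hn; lia.
    - now apply NoDup_remove_1 in Hdup.
    - intros i Hi; apply Hpos, in_app_iff; apply in_app_iff in Hi; simpl; tauto. }
  assert (Hinv : / INR j <= / INR (S n))
    by (apply Rinv_le_contravar; [apply lt_0_INR; lia|apply le_INR; lia]).
  rewrite harmonic_S; rewrite inv_sum_app in Hrest |- *.
  change (inv_sum (j :: l2)) with (/ INR j + inv_sum l2); lra.
Qed.

Lemma sum_n_inv_INR (u : nat -> nat) (n : nat) :
  sum_n (fun i => / INR (u i)) n = inv_sum (map u (seq 0 (S n))) :> R.
Proof.
induction n as [|n IH].
- rewrite sum_O; simpl; ring.
- rewrite sum_Sn_R, IH, (seq_S (S n)), map_app, inv_sum_app; simpl; ring.
Qed.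

Lemma sum_n_inv_injective_le (u : nat -> nat) (n : nat) :
  (forall i, (i <= n)%nat -> (1 <= u i)%nat) ->
  (forall i j, (i <= n)%nat -> (j <= n)%nat -> u i = u j -> i = j) ->
  sum_n (fun i => / INR (u i)) n <= harmonic (S n).
Proof.
intros Hpos Hinj; rewrite sum_n_inv_INR.
replace (S n) with (length (map u (seq 0 (S n)))) at 2 by now rewrite length_map, length_seq.
apply inv_sum_le_harmonic.
- apply NoDup_map_NoDup_ForallPairs; [|apply seq_NoDup].
  intros i j Hi Hj; apply in_seq in Hi; apply in_seq in Hj; apply Hinj; lia.
- intros j Hj; apply in_map_iff in Hj; destruct Hj as [i [<- Hi]].
  apply in_seq in Hi; apply Hpos; lia.
Qed.

Lemma INR_to_nat_Int_part (x : R) : 0 <= x ->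
  INR (Z.to_nat (Int_part x)) <= x < INR (Z.to_nat (Int_part x)) + 1.
Proof.
intros Hx; destruct (base_Int_part x) as [Hle Hgt].
assert (Hnonneg : (-1 < Int_part x)%Z) by (apply lt_IZR; lra).
rewrite INR_IZR_INZ, Z2Nat.id by lia; lra.
Qed.

Lemma sum_n_inv_separated_le (y : nat -> R) (s : R) (n : nat) : 0 < s ->
  (forall i, (i <= n)%nat -> s <= y i) ->
  (forall i j, (i <= n)%nat -> (j <= n)%nat -> i <> j -> s <= Rabs (y i - y j)) ->
  sum_n (fun i => / y i) n <= / s * harmonic (S n).
Proof.
intros Hs Hy Hsep.
set (u := fun i => Z.to_nat (Int_part (y i / s))).
assert (Hu : forall i, (i <= n)%nat -> INR (u i) <= y i / s < INR (u i) + 1).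
{ intros i Hi; apply INR_to_nat_Int_part, Rdiv_le_0_compat; [|exact Hs].
  specialize (Hy i Hi); lra. }
assert (Hu1 : forall i, (i <= n)%nat -> (1 <= u i)%nat).
{ intros i Hi; specialize (Hu i Hi).
  assert (Hquot : 1 <= y i / s) by (apply Rle_div_r; [exact Hs|specialize (Hy i Hi); lra]).
  assert (Hui : (0 < u i)%nat) by (apply INR_lt; simpl; lra); lia. }
assert (Hinj : forall i j, (i <= n)%nat -> (j <= n)%nat -> u i = u j -> i = j).
{ intros i j Hi Hj E; destruct (Nat.eq_dec i j) as [|Hij]; [assumption|exfalso].
  pose proof (Hu i Hi) as Hui; pose proof (Hu j Hj) as Huj; rewrite E in Hui.
  specialize (Hsep i j Hi Hj Hij).
  assert (Hlt : Rabs (y i / s - y j / s) < 1) by (apply Rabs_def1; lra).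
  replace (y i - y j) with (s * (y i / s - y j / s)) in Hsep by (field; lra).
  rewrite Rabs_mult, (Rabs_pos_eq s) in Hsep by lra; nra. }
apply (Rle_trans _ (/ s * sum_n (fun i => / INR (u i)) n)).
- rewrite <- sum_n_mult_l_R, !sum_n_Reals; apply sum_Rle; intros i Hi.
  specialize (Hu i Hi); specialize (Hu1 i Hi).
  assert (Hui : 0 < INR (u i)) by (apply lt_0_INR; lia).
  rewrite <- Rinv_mult; apply Rinv_le_contravar; [now apply Rmult_lt_0_compat|].
  rewrite Rmult_comm; apply Rle_div_r; [exact Hs|apply Hu].
- apply Rmult_le_compat_l; [left; now apply Rinv_0_lt_compat|].
  now apply sum_n_inv_injective_le.
Qed.

Lemma sum_n_harmonic (n : nat) :
  sum_n (fun k => harmonic k + 1) n = INR (S n) * harmonic (S n) :> R.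
Proof.
induction n as [|n IH].
- rewrite sum_O, harmonic_S; unfold harmonic; simpl; field.
- rewrite sum_Sn_R, IH, (harmonic_S (S n)), (S_INR (S n)).
  pose proof (pos_INR (S n)); field; lra.
Qed.

Lemma harmonic_ge0 (n : nat) : 0 <= harmonic n.
Proof.
induction n as [|n IH]; [apply Rle_refl|].
rewrite harmonic_S; assert (0 < / INR (S n)) by (apply Rinv_0_lt_compat, lt_0_INR; lia); lra.
Qed.

(* The subtracted term is chosen so that its decrements dominate the summands. *)
Lemma sum_n_harmonic_div_sqr_le (n : nat) :
  sum_n (fun k => (harmonic k + 1) * / INR (S k) ^ 2) n
  <= 4 - (harmonic (S n) + 2) / INR (S n).
Proof.
induction n as [|n IH].
- rewrite sum_O, harmonic_S; unfold harmonic; simpl; lra.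
- rewrite sum_Sn_R, (harmonic_S (S n)), (S_INR (S n)).
  pose proof (harmonic_ge0 (S n)) as Hh; set (h := harmonic (S n)) in *.
  assert (Hx : 0 < INR (S n)) by (apply lt_0_INR; lia); set (x := INR (S n)) in *.
  assert (Hdecrement : (h + 2) / x - (h + / (x + 1) + 2) / (x + 1) - (h + 1) * / (x + 1) ^ 2
                       = (h + 2) / (x * (x + 1) ^ 2)) by (field; lra).
  assert (Hpos : 0 <= (h + 2) / (x * (x + 1) ^ 2)).
  { apply Rdiv_le_0_compat; [lra|apply Rmult_lt_0_compat; [|apply pow_lt]; lra]. }
  lra.
Qed.

(* By separation the first [n] reciprocals add up to at most [n * harmonic n / s], so Abel
   summation compares the series with the sum of the [(harmonic k + 1) / (k + 1) ^ 2]. *)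
Lemma ex_series_inv_separated (y : nat -> R) (s : R) : 0 < s ->
  (forall n i, (i <= n)%nat -> s / INR (S n) <= y i) ->
  (forall n i j, (i <= n)%nat -> (j <= n)%nat -> i <> j ->
     s / INR (S n) <= Rabs (y i - y j)) ->
  ex_series (fun k => / y k * / INR (S k) ^ 2).
Proof.
intros Hs Hy Hsep.
assert (HS : forall k, 0 < INR (S k)) by (intros k; apply lt_0_INR; lia).
assert (Hpos : forall k, 0 < y k).
{ intros k; apply (Rlt_le_trans _ (s / INR (S k))); [|now apply Hy].
  now apply Rdiv_lt_0_compat. }
assert (Hsum : forall n, sum_n (fun i => / y i) n
                         <= sum_n (fun k => / s * (harmonic k + 1)) n).
{ intros n; rewrite sum_n_mult_l_R, sum_n_harmonic, <- Rmult_assoc.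
  replace (/ s * INR (S n)) with (/ (s / INR (S n))) by (rewrite Rinv_div; apply Rmult_comm).
  apply sum_n_inv_separated_le; [now apply Rdiv_lt_0_compat|now apply Hy|now apply Hsep]. }
apply (ex_series_bounded _ (/ s * 4)).
- intros k; left; apply Rmult_lt_0_compat; apply Rinv_0_lt_compat; [apply Hpos|].
  now apply pow_lt.
- intros n.
  apply (Rle_trans _ (sum_n (fun k => / s * (harmonic k + 1) * / INR (S k) ^ 2) n)).
  + apply sum_n_le_abel; [|exact Hsum]; intros k.
    split; [left; now apply Rinv_0_lt_compat, pow_lt|].
    apply Rinv_le_contravar; [now apply pow_lt|].
    apply pow_incr; specialize (HS k); rewrite (S_INR (S k)); lra.
  + rewrite (sum_n_ext _ (fun k => / s * ((harmonic k + 1) * / INR (S k) ^ 2)))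
      by (intros k; apply Rmult_assoc).
    rewrite sum_n_mult_l_R; apply Rmult_le_compat_l; [left; now apply Rinv_0_lt_compat|].
    pose proof (sum_n_harmonic_div_sqr_le n).
    assert (0 <= (harmonic (S n) + 2) / INR (S n)); [|lra].
    apply Rdiv_le_0_compat; [pose proof (harmonic_ge0 (S n)); lra|apply HS].
Qed.

(** * Badly approximable numbers *)

(* Testing against [|m| + |n|] rather than [|n|] makes the notion visibly
   invariant under integral Moebius transformations. *)
Definition badly_approximable (th : R) : Prop :=
  exists c, 0 < c /\ forall m n : Z, (m <> 0 \/ n <> 0)%Z ->
    c <= Rabs (IZR m - th * IZR n) * (Rabs (IZR m) + Rabs (IZR n)).

Lemma badly_approximable_neq (th : R) (m n : Z) : badly_approximable th ->
  (m <> 0 \/ n <> 0)%Z -> IZR m <> th * IZR n.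
Proof.
intros [c [Hc H]] Hmn E; specialize (H m n Hmn).
rewrite E, Rminus_diag, Rabs_R0, Rmult_0_l in H; lra.
Qed.

Lemma badly_approximable_neq0 (th : R) : badly_approximable th -> th <> 0.
Proof.
intros H E; apply (badly_approximable_neq th 0 1 H); [lia|rewrite E; ring].
Qed.

Lemma badly_approximable_moebius_denominator (th : R) (c d : Z) :
  badly_approximable th -> (c <> 0 \/ d <> 0)%Z -> IZR c * th + IZR d <> 0.
Proof.
intros Hth Hcd E; apply (badly_approximable_neq th d (- c) Hth); [lia|rewrite opp_IZR; lra].
Qed.

Lemma adjugate_pair_neq0 (a b c d m n : Z) : (a * d - b * c <> 0)%Z ->
  (m <> 0 \/ n <> 0)%Z -> (m * d - n * b <> 0 \/ n * a - m * c <> 0)%Z.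
Proof.
intros Hdet Hmn.
destruct (Z.eq_dec (m * d - n * b) 0) as [Hfst|]; [|lia].
destruct (Z.eq_dec (n * a - m * c) 0) as [Hsnd|]; [|lia].
assert (Hm : ((a * d - b * c) * m = 0)%Z).
{ transitivity (a * (m * d - n * b) + b * (n * a - m * c))%Z; [ring|rewrite Hfst, Hsnd; ring]. }
assert (Hn : ((a * d - b * c) * n = 0)%Z).
{ transitivity (c * (m * d - n * b) + d * (n * a - m * c))%Z; [ring|rewrite Hfst, Hsnd; ring]. }
apply Z.mul_eq_0 in Hm, Hn; lia.
Qed.

Lemma adjugate_pair_size (a b c d m n : R) :
  Rabs (m * d - n * b) + Rabs (n * a - m * c)
  <= (Rabs a + Rabs b + Rabs c + Rabs d) * (Rabs m + Rabs n).
Proof.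
pose proof (Rabs_triang (m * d) (- (n * b))) as Hm.
pose proof (Rabs_triang (n * a) (- (m * c))) as Hn.
rewrite Rabs_Ropp, !Rabs_mult in Hm, Hn.
pose proof (Rabs_pos a); pose proof (Rabs_pos b); pose proof (Rabs_pos c).
pose proof (Rabs_pos d); pose proof (Rabs_pos m); pose proof (Rabs_pos n).
unfold Rminus; nra.
Qed.

Lemma badly_approximable_moebius (th : R) (a b c d : Z) :
  badly_approximable th -> (a * d - b * c <> 0)%Z ->
  badly_approximable ((IZR a * th + IZR b) / (IZR c * th + IZR d)).
Proof.
intros Hth Hdet.
assert (Hden : IZR c * th + IZR d <> 0)
  by (apply badly_approximable_moebius_denominator; [exact Hth|nia]).
destruct Hth as [e [He H]].
pose proof (Rabs_pos_lt _ Hden) as Hden0; set (den := IZR c * th + IZR d) in *.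
set (L := Rabs (IZR a) + Rabs (IZR b) + Rabs (IZR c) + Rabs (IZR d)).
assert (HL : 0 < L).
{ unfold L; rewrite <- !abs_IZR, <- !plus_IZR; apply IZR_lt; nia. }
exists (e / (Rabs den * L)); split; [now apply Rdiv_lt_0_compat, Rmult_lt_0_compat|].
intros m n Hmn; apply Rle_div_l; [now apply Rmult_lt_0_compat|].
apply (Rle_trans _ _ _ (H _ _ (adjugate_pair_neq0 a b c d m n Hdet Hmn))).
rewrite !minus_IZR, !mult_IZR.
replace (IZR m * IZR d - IZR n * IZR b - th * (IZR n * IZR a - IZR m * IZR c))
  with ((IZR m - (IZR a * th + IZR b) / den * IZR n) * den).
2:{ transitivity (IZR m * den - (IZR a * th + IZR b) * IZR n); [field; exact Hden|].
    unfold den; ring. }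
rewrite Rabs_mult; set (A := Rabs (IZR m - (IZR a * th + IZR b) / den * IZR n)).
replace (A * (Rabs (IZR m) + Rabs (IZR n)) * (Rabs den * L))
  with (A * Rabs den * (L * (Rabs (IZR m) + Rabs (IZR n)))) by ring.
apply Rmult_le_compat_l; [apply Rmult_le_pos; apply Rabs_pos|apply adjugate_pair_size].
Qed.

Lemma quadratic_badly_approximable (th : R) (p q : Z) : IZR q * th ^ 2 = IZR p ->
  (forall m n, (m <> 0 \/ n <> 0)%Z -> (q * (m * m) - p * (n * n) <> 0)%Z) ->
  badly_approximable th.
Proof.
intros Hth Hform.
assert (Hq : 1 <= Rabs (IZR q)).
{ rewrite <- abs_IZR; apply IZR_le; specialize (Hform 1%Z 0%Z); lia. }
pose proof (Rabs_pos th) as Ht.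
exists (/ (Rabs (IZR q) * (1 + Rabs th))); split; [apply Rinv_0_lt_compat; nra|].
intros m n Hmn; specialize (Hform m n Hmn).
assert (Hnorm : 1 <= Rabs (IZR q)
                     * (Rabs (IZR m - th * IZR n) * Rabs (IZR m + th * IZR n))).
{ rewrite <- !Rabs_mult.
  replace (IZR q * ((IZR m - th * IZR n) * (IZR m + th * IZR n)))
    with (IZR (q * (m * m) - p * (n * n)))
    by (rewrite minus_IZR, !mult_IZR, <- Hth; ring).
  rewrite <- abs_IZR; apply IZR_le; lia. }
assert (Hconj : Rabs (IZR m + th * IZR n) <= (1 + Rabs th) * (Rabs (IZR m) + Rabs (IZR n))).
{ apply (Rle_trans _ _ _ (Rabs_triang _ _)); rewrite Rabs_mult.
  pose proof (Rabs_pos (IZR m)); pose proof (Rabs_pos (IZR n)); nra. }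
rewrite <- (Rmult_1_l (/ _)); apply Rle_div_l; [nra|].
apply (Rle_trans _ _ _ Hnorm).
rewrite (Rmult_comm _ (_ * (1 + _))), Rmult_assoc; apply Rmult_le_compat_l; [lra|].
rewrite (Rmult_comm (1 + _)), Rmult_assoc, (Rmult_comm (Rabs (IZR m) + _)).
apply Rmult_le_compat_l; [apply Rabs_pos|exact Hconj].
Qed.

Definition nearest_odd (x : R) : Z := (2 * Int_part (x / 2) + 1)%Z.

Definition odd_gap (x : R) : R := Rabs (IZR (nearest_odd x) - x).

Lemma odd_gap_le1 (x : R) : odd_gap x <= 1.
Proof.
unfold odd_gap, nearest_odd; rewrite plus_IZR, mult_IZR.
destruct (base_Int_part (x / 2)); apply Rabs_le; lra.
Qed.

Lemma Rabs_nearest_odd_le (x : R) : Rabs (IZR (nearest_odd x)) <= 1 + Rabs x.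
Proof.
replace (IZR (nearest_odd x)) with (IZR (nearest_odd x) - x + x) by ring.
apply (Rle_trans _ _ _ (Rabs_triang _ _)), Rplus_le_compat_r, odd_gap_le1.
Qed.

Lemma odd_gap_le_cos (x : R) : odd_gap x / 2 <= Rabs (cos (PI / 2 * x)).
Proof.
pose proof (odd_gap_le1 x) as Hle1; pose proof PI2_3_2 as HPI.
assert (Ecos : Rabs (cos (PI / 2 * x)) = Rabs (sin (PI / 2 * odd_gap x))).
{ replace (PI / 2 * x)
    with (PI / 2 - PI / 2 * (IZR (nearest_odd x) - x) + IZR (Int_part (x / 2)) * PI)
    by (unfold nearest_odd; rewrite plus_IZR, mult_IZR; field).
  rewrite cos_add_mul_PI, Rabs_mult, Rabs_parity_sign, Rmult_1_l, cos_shift.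
  unfold odd_gap, Rabs at 3; destruct Rcase_abs; [|reflexivity].
  now rewrite Ropp_mult_distr_r_reverse, sin_neg, Rabs_Ropp. }
assert (Hge0 : 0 <= odd_gap x) by apply Rabs_pos.
rewrite Ecos; apply (Rle_trans _ (sin (PI / 2 * odd_gap x))); [|apply Rle_abs].
pose proof (sin_ge_third (PI / 2 * odd_gap x) ltac:(nra)); nra.
Qed.

Lemma Rabs_minus_Rabs_ge (s x y : R) :
  s <= Rabs (x - y) -> s <= Rabs (x + y) -> s <= Rabs (Rabs x - Rabs y).
Proof. unfold Rabs; repeat destruct Rcase_abs; lra. Qed.

Lemma badly_approximable_lattice_gap (th L : R) : badly_approximable th -> 0 < L ->
  exists s, 0 < s /\ forall (n : nat) (a b : Z), (a <> 0 \/ b <> 0)%Z ->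
    Rabs (IZR a) + Rabs (IZR b) <= L * INR (S n) -> s / INR (S n) <= Rabs (IZR a - th * IZR b).
Proof.
intros [c [Hc H]] HL; exists (c / L); split; [now apply Rdiv_lt_0_compat|].
intros n a b Hab Hsize; assert (HS : 0 < INR (S n)) by (apply lt_0_INR; lia).
replace (c / L / INR (S n)) with (c / (L * INR (S n))) by (field; lra).
apply Rle_div_l; [now apply Rmult_lt_0_compat|].
apply (Rle_trans _ _ _ (H a b Hab)), Rmult_le_compat_l; [apply Rabs_pos|exact Hsize].
Qed.

Lemma nearest_odd_pair_size (th : R) (k n : nat) : (k <= n)%nat ->
  Rabs (IZR (nearest_odd (th * nth_odd k))) + nth_odd k <= 2 * (1 + Rabs th) * INR (S n).
Proof.
intros Hk; apply le_INR in Hk.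
pose proof (Rabs_nearest_odd_le (th * nth_odd k)) as Hm; pose proof (nth_odd_ge1 k).
rewrite Rabs_mult, (Rabs_pos_eq (nth_odd k)) in Hm by lra.
assert (Hodd : nth_odd k <= 2 * INR (S n) - 1) by (unfold nth_odd; rewrite S_INR; lra).
pose proof (Rmult_le_compat_l (Rabs th) _ _ (Rabs_pos th) Hodd) as Hth.
pose proof (Rabs_pos th); lra.
Qed.

(* [odd_gap (th i) - odd_gap (th j)] is, up to sign, the difference or the sum of two lattice
   points [m - th n], so both of these have to be kept away from 0. *)
Lemma badly_approximable_odd_gap_separated (th : R) : badly_approximable th ->
  exists s, 0 < s /\
    (forall n i, (i <= n)%nat -> s / INR (S n) <= odd_gap (th * nth_odd i)) /\
    (forall n i j, (i <= n)%nat -> (j <= n)%nat -> i <> j ->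
       s / INR (S n) <= Rabs (odd_gap (th * nth_odd i) - odd_gap (th * nth_odd j))).
Proof.
intros Hth; pose proof (Rabs_pos th) as Ht.
destruct (badly_approximable_lattice_gap th (2 * (2 * (1 + Rabs th))) Hth) as [s [Hs Hgap]];
  [lra|].
set (m := fun k => nearest_odd (th * nth_odd k)).
set (o := fun k => (2 * Z.of_nat k + 1)%Z).
assert (Ho : forall k, nth_odd k = IZR (o k)) by (intros k; symmetry; apply IZR_nth_odd).
assert (Hsize : forall n k, (k <= n)%nat ->
  Rabs (IZR (m k)) + Rabs (IZR (o k)) <= 2 * (1 + Rabs th) * INR (S n)).
{ intros n k Hk; rewrite <- Ho, (Rabs_pos_eq (nth_odd k)) by (pose proof (nth_odd_ge1 k); lra).
  now apply nearest_odd_pair_size. }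
exists s; split; [exact Hs|split].
- intros n i Hi; unfold odd_gap; fold (m i); rewrite Ho.
  apply Hgap; [unfold o; lia|]; specialize (Hsize n i Hi).
  pose proof (Rabs_pos (IZR (m i))); pose proof (Rabs_pos (IZR (o i))); lra.
- intros n i j Hi Hj Hij; unfold odd_gap; fold (m i) (m j); rewrite !Ho.
  pose proof (Hsize n i Hi) as Hsi; pose proof (Hsize n j Hj) as Hsj.
  apply Rabs_minus_Rabs_ge.
  + replace (IZR (m i) - th * IZR (o i) - (IZR (m j) - th * IZR (o j)))
      with (IZR (m i - m j) - th * IZR (o i - o j)) by (rewrite !minus_IZR; ring).
    apply Hgap; [unfold o; lia|]; rewrite !minus_IZR.
    pose proof (Rabs_triang (IZR (m i)) (- IZR (m j))) as Hm.
    pose proof (Rabs_triang (IZR (o i)) (- IZR (o j))) as Hoij.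
    rewrite Rabs_Ropp in Hm, Hoij; unfold Rminus; lra.
  + replace (IZR (m i) - th * IZR (o i) + (IZR (m j) - th * IZR (o j)))
      with (IZR (m i + m j) - th * IZR (o i + o j)) by (rewrite !plus_IZR; ring).
    apply Hgap; [unfold o; lia|]; rewrite !plus_IZR.
    pose proof (Rabs_triang (IZR (m i)) (IZR (m j))).
    pose proof (Rabs_triang (IZR (o i)) (IZR (o j))); lra.
Qed.

Lemma cos_PI2_neq0 (y : R) : (forall i, y <> IZR (2 * i + 1)) -> cos (PI / 2 * y) <> 0.
Proof.
intros Hy E; apply cos_eq_0_0 in E; destruct E as [i Hi].
apply (Hy i); rewrite plus_IZR, mult_IZR; pose proof PI_RGT_0.
apply (Rmult_eq_reg_l (PI / 2)); [|lra]; rewrite Hi; field.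
Qed.

Lemma badly_approximable_cos_neq0 (th : R) (k : nat) : badly_approximable th ->
  cos (PI / 2 * (th * nth_odd k)) <> 0.
Proof.
intros Hth; apply cos_PI2_neq0; intros i E; rewrite <- IZR_nth_odd in E; symmetry in E; revert E.
apply badly_approximable_neq; [exact Hth|lia].
Qed.

Lemma badly_approximable_cos_div_neq0 (th : R) (k : nat) : badly_approximable th ->
  cos (PI / 2 * (nth_odd k / th)) <> 0.
Proof.
intros Hth; apply cos_PI2_neq0; intros i E.
apply (badly_approximable_neq th (2 * Z.of_nat k + 1) (2 * i + 1) Hth); [lia|].
rewrite IZR_nth_odd, <- E; field; now apply badly_approximable_neq0.
Qed.

Lemma badly_approximable_secant_summable (th : R) : badly_approximable th ->
  ex_series (fun k => / (nth_odd k ^ 2 * Rabs (cos (PI / 2 * (th * nth_odd k))))).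
Proof.
intros Hth.
destruct (badly_approximable_odd_gap_separated th Hth) as [s [Hs [Hgap Hsep]]].
pose proof (ex_series_inv_separated (fun k => odd_gap (th * nth_odd k)) s Hs Hgap Hsep) as Hex.
apply (ex_series_scal_l (V := R_NormedModule) 2) in Hex.
apply (ex_series_le (V := R_CompleteNormedModule) _ _) with (2 := Hex); intros k.
change (Rabs (/ (nth_odd k ^ 2 * Rabs (cos (PI / 2 * (th * nth_odd k)))))
        <= 2 * (/ odd_gap (th * nth_odd k) * / INR (S k) ^ 2)).
assert (HS : 0 < INR (S k)) by (apply lt_0_INR; lia).
assert (Hgap0 : 0 < odd_gap (th * nth_odd k))
  by (apply (Rlt_le_trans _ (s / INR (S k))); [now apply Rdiv_lt_0_compat|now apply Hgap]).
pose proof (odd_gap_le_cos (th * nth_odd k)) as Hcos; pose proof (nth_odd_ge1 k) as Hodd.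
rewrite Rabs_pos_eq by (left; apply Rinv_0_lt_compat, Rmult_lt_0_compat; [apply pow_lt|]; lra).
replace (2 * (/ odd_gap (th * nth_odd k) * / INR (S k) ^ 2))
  with (/ (INR (S k) ^ 2 * (odd_gap (th * nth_odd k) / 2))) by (field; lra).
apply Rinv_le_contravar; [apply Rmult_lt_0_compat; [apply pow_lt|]; lra|].
apply Rmult_le_compat; [apply pow_le; lra|lra| |exact Hcos].
apply pow_incr; split; [lra|].
unfold nth_odd; rewrite S_INR; pose proof (pos_INR k); lra.
Qed.

(** * Reciprocity *)

Definition tan_term (x : R) (k : nat) : R :=
  (-1) ^ k * (tan (nth_odd k * PI * x) / nth_odd k ^ 2).

Lemma sec_minus_one_column (th : R) (m : nat) : badly_approximable th ->
  is_series (fun n => sec_minus_one_term (th * nth_odd n) m)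
    (- (PI / (4 * th)) * tan_term (/ (2 * th)) m).
Proof.
intros Hth; pose proof (nth_odd_ge1 m) as Hm; pose proof (badly_approximable_neq0 th Hth) as Ht.
pose proof (badly_approximable_cos_div_neq0 th m Hth) as Hcos.
assert (Hdiv : nth_odd m / th <> 0)
  by (apply Rmult_integral_contrapositive_currified; [lra|now apply Rinv_neq_0_compat]).
pose proof (tan_partial_fractions _ Hcos Hdiv) as Hpf.
apply (is_series_mult_l_R (- ((-1) ^ m / (nth_odd m * th ^ 2)))) in Hpf.
revert Hpf; apply is_series_eq.
- intros n; unfold sec_minus_one_term.
  pose proof (nth_odd_sqr_minus_neq0 n _ Hcos) as Hsqr.
  set (x := nth_odd n ^ 2 - (nth_odd m / th) ^ 2) in *.
  replace (nth_odd m ^ 2 - (th * nth_odd n) ^ 2) with (- th ^ 2 * x)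
    by (unfold x; field; exact Ht).
  field; repeat split; [exact Hsqr|exact Ht|lra].
- unfold tan_term; replace (nth_odd m * PI * / (2 * th)) with (PI / 2 * (nth_odd m / th))
    by (field; exact Ht).
  field; split; [lra|exact Ht].
Qed.

Definition reciprocal_value (T x : R) : R := / 2 - 4 * x / PI ^ 2 * T.

Lemma f_term_eq_sec_minus_one (th : R) (n : nat) : badly_approximable th ->
  f_term (th / 2) n
  = 16 * th ^ 2 / PI ^ 3
      * (PI / 4 / (th * nth_odd n) ^ 2 * (/ cos (PI / 2 * (th * nth_odd n)) - 1))
    + 4 / PI ^ 2 * / nth_odd n ^ 2.
Proof.
intros Hth; pose proof PI_RGT_0; pose proof (nth_odd_ge1 n).
pose proof (badly_approximable_cos_neq0 th n Hth); pose proof (badly_approximable_neq0 th Hth).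
unfold f_term; fold (nth_odd n).
replace (nth_odd n * PI * (th / 2)) with (PI / 2 * (th * nth_odd n)) by field.
field; repeat split; first [lra|assumption].
Qed.

Lemma secant_reciprocity (th : R) : badly_approximable th ->
  exists T, is_series (tan_term (/ (2 * th))) T /\ f_equals (th / 2) (reciprocal_value T th).
Proof.
intros Hth; pose proof (badly_approximable_neq0 th Hth) as Ht; pose proof PI_RGT_0 as HPI.
set (row := fun n => PI / 4 / (th * nth_odd n) ^ 2 * (/ cos (PI / 2 * (th * nth_odd n)) - 1)).
assert (Hy0 : forall n, th * nth_odd n <> 0).
{ intros n; pose proof (nth_odd_ge1 n).
  apply Rmult_integral_contrapositive_currified; [exact Ht|lra]. }
destruct (tannery (fun M n => sum_n (sec_minus_one_term (th * nth_odd n)) M) row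
  (fun n => 2 * PI / th ^ 2 * / (nth_odd n ^ 2 * Rabs (cos (PI / 2 * (th * nth_odd n))))))
  as [Hrow Hlim].
- intros M n; pose proof (nth_odd_ge1 n).
  pose proof (badly_approximable_cos_neq0 th n Hth) as Hcos.
  replace (2 * PI / th ^ 2 * / (nth_odd n ^ 2 * Rabs (cos (PI / 2 * (th * nth_odd n)))))
    with (2 * PI * / ((th * nth_odd n) ^ 2 * Rabs (cos (PI / 2 * (th * nth_odd n))))).
  + now apply sec_minus_one_partial_sum_bound.
  + apply Rabs_no_R0 in Hcos; field; repeat split; first [lra|assumption].
- apply (ex_series_scal_l (V := R_NormedModule) (2 * PI / th ^ 2)).
  now apply badly_approximable_secant_summable.
- intros n; apply sec_minus_one_partial_fractions; [|apply Hy0].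
  now apply badly_approximable_cos_neq0.
- exists (- (4 * th / PI) * Series row); split.
  + assert (Hcol : is_series (fun m => - (PI / (4 * th)) * tan_term (/ (2 * th)) m) (Series row)).
    { apply (is_lim_seq_ext _ (sum_n (fun m => - (PI / (4 * th)) * tan_term (/ (2 * th)) m)))
        in Hlim; [exact Hlim|].
      intros M; apply is_series_unique.
      apply (is_series_sum_n (fun n => sec_minus_one_term (th * nth_odd n))).
      intros m; now apply sec_minus_one_column. }
    apply (is_series_mult_l_R (- (4 * th / PI))) in Hcol; revert Hcol; apply is_series_eq;
      [|reflexivity].
    intros m; field; split; [exact Ht|lra].
  + pose proof (is_series_plus_R _ _ _ _
      (is_series_mult_l_R (16 * th ^ 2 / PI ^ 3) _ _ (Series_correct _ Hrow))
      (is_series_mult_l_R (4 / PI ^ 2) _ _ is_series_inv_nth_odd_sqr)) as Hf.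
    revert Hf; apply is_series_eq.
    * intros n; symmetry; now apply f_term_eq_sec_minus_one.
    * unfold reciprocal_value; field; lra.
Qed.

(** * Quadratic irrationals *)

(* Descent: a solution [s = m x], [x ^ 2 = N (N + 1)], yields the smaller one
   with [m' = m (x - N)], since [N < x < N + 1]. *)
Lemma consecutive_product_sqr_neq (N m s : Z) : (1 <= N)%Z -> (0 < m)%Z -> (0 < s)%Z ->
  (N * (N + 1) * (m * m) <> s * s)%Z.
Proof.
intros HN Hm; assert (Hm0 : (0 <= m)%Z) by lia; revert s Hm.
apply (Z_lt_induction (fun m => forall s, (0 < m)%Z -> (0 < s)%Z ->
  (N * (N + 1) * (m * m) <> s * s)%Z)); [|exact Hm0].
clear m Hm0; intros m IH s Hm Hs E.
assert (Hlow : (N * m < s)%Z) by nia.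
assert (Hhigh : (s < (N + 1) * m)%Z) by nia.
apply (IH (s - N * m)%Z ltac:(nia) (N * (N + 1) * m - N * s)%Z ltac:(lia)); [nia|].
transitivity (N * (N + 1) * (s * s) - 2 * N * (N * (N + 1)) * s * m
              + N * N * (N * (N + 1) * (m * m)))%Z; [ring|].
rewrite E; transitivity (N * (N + 1) * (N * (N + 1) * (m * m))
  - 2 * N * (N * (N + 1)) * s * m + N * N * (s * s))%Z; [rewrite E|]; ring.
Qed.

Lemma consecutive_product_sqr_eq_0 (N m s : Z) : (N * (N + 1) <> 0)%Z ->
  (N * (N + 1) * (m * m) = s * s)%Z -> m = 0%Z.
Proof.
intros HN E; destruct (Z.eq_dec m 0) as [|Hm]; [assumption|exfalso].
assert (Hs : s <> 0%Z) by (intros ->; apply HN; nia).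
rewrite <- (Z.abs_square m), <- (Z.abs_square s) in E.
destruct (Z_lt_dec 0 N) as [Hpos|Hneg].
- apply (consecutive_product_sqr_neq N (Z.abs m) (Z.abs s)); [lia..|exact E].
- apply (consecutive_product_sqr_neq (- N - 1) (Z.abs m) (Z.abs s)); [nia|lia..|].
  rewrite <- E; ring.
Qed.

Lemma mul_sqrt_div_sqr (p q : Z) : (0 <= p * q)%Z -> q <> 0%Z ->
  IZR q * sqrt (IZR p / IZR q) ^ 2 = IZR p.
Proof.
intros Hpq Hq; apply not_0_IZR in Hq.
rewrite pow2_sqrt; [field; exact Hq|].
replace (IZR p / IZR q) with (IZR (p * q) / IZR q ^ 2) by (rewrite mult_IZR; field; exact Hq).
apply Rdiv_le_0_compat; [now apply IZR_le|now apply pow2_gt_0].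
Qed.

Lemma sqrt_badly_approximable (p q N : Z) : (p * q = N * (N + 1))%Z -> (p * q <> 0)%Z ->
  badly_approximable (sqrt (IZR p / IZR q)).
Proof.
intros HN Hpq; apply (quadratic_badly_approximable _ p q).
- apply mul_sqrt_div_sqr; [rewrite HN; destruct (Z_le_dec 0 N)|]; nia.
- intros m n Hmn E.
  assert (Hm : m = 0%Z).
  { apply (consecutive_product_sqr_eq_0 N m (p * n)); [now rewrite <- HN|].
    rewrite <- HN; transitivity (p * (q * (m * m)))%Z; [ring|].
    replace (q * (m * m))%Z with (p * (n * n))%Z by lia; ring. }
  assert (Hp : p <> 0%Z) by (intros ->; now apply Hpq).
  assert (Hn : (p * (n * n) = 0)%Z) by (rewrite Hm in E; lia).
  apply Z.mul_eq_0 in Hn; destruct Hn as [|Hn]; [contradiction|nia].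
Qed.

Lemma tan_term_shift (x : R) (i : Z) (k : nat) : tan_term (x + IZR i) k = tan_term x k.
Proof.
unfold tan_term, tan.
replace (nth_odd k * PI * (x + IZR i))
  with (nth_odd k * PI * x + IZR ((2 * Z.of_nat k + 1) * i) * PI)
  by (rewrite mult_IZR, IZR_nth_odd; ring).
rewrite cos_add_mul_PI, sin_add_mul_PI, parity_sign_odd_mul.
unfold Rdiv; rewrite Rinv_mult, parity_sign_inv.
set (x' := nth_odd k * PI * x); set (e := parity_sign i).
replace (e * sin x' * (e * / cos x')) with (e * e * (sin x' * / cos x')) by ring.
unfold e; now rewrite parity_sign_sqr, Rmult_1_l.
Qed.

Lemma f_equals_shift (r v : R) (i : Z) :
  f_equals r v -> f_equals (r + IZR i) (parity_sign i * v).
Proof.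
intros H; apply (is_series_mult_l_R (parity_sign i)) in H; revert H.
apply is_series_eq; [|reflexivity]; intros k.
unfold f_term; fold (nth_odd k).
replace (nth_odd k * PI * (r + IZR i))
  with (nth_odd k * PI * r + IZR ((2 * Z.of_nat k + 1) * i) * PI)
  by (rewrite mult_IZR, IZR_nth_odd; ring).
rewrite cos_add_mul_PI, parity_sign_odd_mul, Rinv_mult, parity_sign_inv.
unfold Rdiv; ring.
Qed.

Lemma f_equals_unique (r v w : R) : f_equals r v -> f_equals r w -> v = w.
Proof. intros Hv Hw; now rewrite <- (is_series_unique _ _ Hv), <- (is_series_unique _ _ Hw). Qed.

Lemma f_equals_moebius (th T : R) (i : Z) : badly_approximable th ->
  is_series (tan_term (/ (2 * th))) T ->
  f_equals (th / (1 + 2 * IZR i * th) / 2) (reciprocal_value T (th / (1 + 2 * IZR i * th))).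
Proof.
intros Hth HT; pose proof (badly_approximable_neq0 th Hth) as Ht.
assert (Hden : 1 + 2 * IZR i * th <> 0).
{ pose proof (badly_approximable_moebius_denominator th (2 * i) 1 Hth ltac:(lia)) as Hneq.
  rewrite mult_IZR in Hneq; lra. }
assert (Hmoebius : badly_approximable (th / (1 + 2 * IZR i * th))).
{ replace (th / (1 + 2 * IZR i * th)) with ((1 * th + 0) / (IZR (2 * i) * th + 1))
    by (rewrite mult_IZR; field; lra).
  apply badly_approximable_moebius; [exact Hth|lia]. }
destruct (secant_reciprocity _ Hmoebius) as [T' [HT' Hf]].
replace T with T'; [exact Hf|].
rewrite <- (is_series_unique _ _ HT), <- (is_series_unique _ _ HT').
apply Series_ext; intros k; rewrite <- (tan_term_shift (/ (2 * th)) i).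
f_equal; field; split; assumption.
Qed.

Lemma moebius_pair_diff_sum (k p q th : R) : q = 2 * k * (2 * p * k + 1) -> q * th ^ 2 = p ->
  q <> 0 ->
  th / (1 + 2 * - k * th) = th / (1 + 2 * k * th) + 2 * p /\
  th / (1 + 2 * k * th) + th / (1 + 2 * - k * th) = th * q / k.
Proof.
intros Eq Hth Hq.
assert (Hk : k <> 0) by (intros E; apply Hq; rewrite Eq, E; ring).
assert (Hprod : (1 + 2 * k * th) * (1 + 2 * - k * th) = 2 * k / q).
{ apply (Rmult_eq_reg_l q); [|exact Hq].
  transitivity (q - 4 * k ^ 2 * (q * th ^ 2)); [ring|].
  rewrite Hth; transitivity (2 * k); [rewrite Eq; ring|field; exact Hq]. }
assert (Hden : 2 * k / q <> 0)
  by (apply Rmult_integral_contrapositive_currified; [lra|now apply Rinv_neq_0_compat]).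
rewrite <- Hprod in Hden; apply Rmult_neq_0_reg in Hden; destruct Hden as [Hplus Hminus].
split.
- apply (Rplus_eq_reg_r (- (th / (1 + 2 * k * th)))).
  transitivity (4 * k * th ^ 2 / ((1 + 2 * k * th) * (1 + 2 * - k * th)));
    [field; split; assumption|].
  rewrite Hprod, <- Hth; field; repeat split; assumption.
- transitivity (2 * th / ((1 + 2 * k * th) * (1 + 2 * - k * th)));
    [field; split; assumption|].
  rewrite Hprod; field; split; assumption.
Qed.

Lemma reciprocal_value_of_shift (T x th q k : R) (p : Z) : q <> 0 -> k <> 0 -> p <> 0%Z ->
  reciprocal_value T (x + 2 * IZR p) = parity_sign p * reciprocal_value T x ->
  x + (x + 2 * IZR p) = th * q / k ->
  reciprocal_value T th = if Z.even p then / 2 else / 2 - k / q.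
Proof.
unfold reciprocal_value, parity_sign; intros Hq Hk Hp Hrel Hsum.
pose proof PI_RGT_0 as HPI; assert (Hp0 : IZR p <> 0) by now apply not_0_IZR.
set (c := 4 / PI ^ 2 * T).
assert (Hc : forall z, 4 * z / PI ^ 2 * T = c * z) by (intros z; unfold c; field; lra).
rewrite !Hc in *; destruct (Z.even p).
- assert (Hpc : IZR p * c = 0) by lra.
  apply Rmult_integral in Hpc; destruct Hpc as [Hpc|Hpc]; [contradiction|rewrite Hpc; ring].
- assert (Hsum1 : c * (th * q / k) = 1) by (rewrite <- Hsum; lra).
  replace (k / q) with (c * (th * q / k) * (k / q)) by (rewrite Hsum1; ring).
  field; split; assumption.
Qed.

Theorem theorem3p2 (K : nat) (p : Z) (hK : (0 < K)%nat) (hp : p <> 0%Z) :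
  let q : R := IZR (2 * Z.of_nat K * (2 * p * Z.of_nat K + 1)) in
  f_equals (/ 2 * sqrt (IZR p / q))
    (if Z.even p then / 2 else / 2 - INR K / q).
Proof.
intros q; set (th := sqrt (IZR p / q)).
assert (HK : INR K <> 0) by (apply not_0_INR; lia).
assert (Hq : q <> 0) by (apply not_0_IZR; nia).
assert (Hth2 : q * th ^ 2 = IZR p)
  by (apply mul_sqrt_div_sqr; [destruct (Z_le_dec 0 p)|]; nia).
assert (Hth : badly_approximable th)
  by (apply (sqrt_badly_approximable p _ (2 * p * Z.of_nat K)); [ring|nia]).
destruct (secant_reciprocity th Hth) as [T [HT Hf]].
pose proof (f_equals_moebius th T (Z.of_nat K) Hth HT) as Hplus.
pose proof (f_equals_moebius th T (- Z.of_nat K) Hth HT) as Hminus.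
rewrite opp_IZR in Hminus; rewrite <- INR_IZR_INZ in Hplus, Hminus.
destruct (moebius_pair_diff_sum (INR K) (IZR p) q th) as [Hdiff Hsum]; [ |exact Hth2|exact Hq|].
- unfold q; rewrite INR_IZR_INZ, !mult_IZR, plus_IZR, !mult_IZR; ring.
- set (x := th / (1 + 2 * INR K * th)) in *; rewrite Hdiff in Hminus, Hsum.
  replace (/ 2 * th) with (th / 2) by field.
  rewrite <- (reciprocal_value_of_shift T x th q (INR K) p Hq HK hp); [exact Hf| |exact Hsum].
  apply (f_equals_unique ((x + 2 * IZR p) / 2)); [exact Hminus|].
  replace ((x + 2 * IZR p) / 2) with (x / 2 + IZR p) by field.
  now apply f_equals_shift.
Qed.
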